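(* Let $p$ be a prime. Then for positive integers $r, a_1, b_1, \ldots, a_r, b_r$, $$S_{p-1}^q\Bigl(\overset{r-1}{\underset{j=1}{\mathbf{Cat}}}\{\{1\}^{a_j-1}, b_j+1\},\, \{1\}^{a_r-1},\, b_r\Bigr)\equiv (-1)^{a_1+b_1+\cdots+a_r+b_r}\,S_{p-1}^q\Bigl(\overset{r-1}{\underset{j=1}{\mathbf{Cat}}}\{\{1\}^{b_{r-j+1}-1}, a_{r-j+1}+1\},\, \{1\}^{b_1-1},\, a_1\Bigr) \pmod{[p]_q}.$$
   Context: Here $q$ is an indeterminate and $[n]_q=\frac{1-q^n}{1-q}=1+q+\cdots+q^{n-1}$. For positive integers $s_1,\dots,s_l$, $$S_n^q(s_1,\ldots,s_l)=\sum_{1\le k_1\le\cdots\le k_l\le n}\prod_{i=1}^l\frac{q^{(s_i-1)k_i}}{[k_i]_q^{s_i}}.$$ $\{s\}^t$ denotes $t\ge0$ consecutive copies of $s$. $\mathbf{Cat}_{j=1}^{m}\{\mathbf{s}_j\}$ denotes the concatenated argument sequence $\mathbf{s}_1,\ldots,\mathbf{s}_m$ (empty if $m=0$). For instance, the argument on the left is $\{1\}^{a_1-1},b_1+1,\{1\}^{a_2-1},b_2+1,\ldots,\{1\}^{a_{r-1}-1},b_{r-1}+1,\{1\}^{a_r-1},b_r$, and on the right it is $\{1\}^{b_r-1},a_r+1,\{1\}^{b_{r-1}-1},a_{r-1}+1,\ldots,\{1\}^{b_2-1},a_2+1,\{1\}^{b_1-1},a_1$. For a prime $p$ and rational functions $A,B$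 in $q$, $A\equiv B\pmod{[p]_q}$ means $A-B=f/g$ with $f,g$ polynomials in $q$ with integer coefficients, $g$ coprime to $[p]_q$ in $\mathbb{Q}[q]$, and $[p]_q\mid f$ ($[p]_q$ is the $p$th cyclotomic polynomial, irreducible over $\mathbb{Q}$). *)

(* Defs.v *)
From HB Require Import structures.
From mathcomp Require Import all_boot all_order all_algebra.

Set Implicit Arguments.
Unset Strict Implicit.
Unset Printing Implicit Defensive.

Import GRing.Theory.
Local Open Scope ring_scope.

(* The field Q(q), where q is the image of 'X. *)
Definition ratfun := {fraction {poly rat}}.

Definition toF (f : {poly rat}) : ratfun := tofrac f.

Definition qvar : ratfun := toF 'X.

(* [n]_q *)
Definition qint (n : nat) : {poly rat} := \sum_(i < n) 'X^i.

(* S_n^q(s_1, ..., s_l), with l = size s.  The condition [path leq 1] says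
   1 <= k_1 <= ... <= k_l; the bound k_l <= n comes from the type 'I_n.+1.
   The exponent s_i - 1 is a truncated subtraction, so s_i >= 1 is meant. *)
Definition Sq (n : nat) (s : seq nat) : ratfun :=
  \sum_(k : (size s).-tuple 'I_n.+1 | path leq 1 [seq nat_of_ord x | x <- k])
    \prod_(i < size s)
      (qvar ^+ ((nth 0%N s i - 1) * tnth k i)
         / toF (qint (tnth k i)) ^+ nth 0%N s i).

Definition ZtoQ (f : {poly int}) : {poly rat} := map_poly intr f.

(* A = B mod m.  Divisibility is taken in Q[q]; for f with integer
   coefficients and m = [p]_q, which is monic with integer coefficients, this
   is the same as divisibility in Z[q]. *)
Definition qcongr (m : {poly rat}) (A B : ratfun) : Prop :=
  exists f g : {poly int},
    [/\ g != 0,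
        A - B = toF (ZtoQ f) / toF (ZtoQ g),
        coprimep (ZtoQ g) m
      & m %| ZtoQ f].

(* Concatenation of F 1, ..., F m. *)
Definition Cat (m : nat) (F : nat -> seq nat) : seq nat :=
  \big[cat/[::]]_(1 <= j < m.+1) F j.

(* Main.v *)
Require Import Defs.
From HB Require Import structures.
From mathcomp Require Import all_boot all_order all_algebra all_field.
From mathcomp Require Import ring zify.

Set Implicit Arguments.
Unset Strict Implicit.
Unset Printing Implicit Defensive.

Import GRing.Theory.
Local Open Scope ring_scope.

(* Since [p]_q is the minimal polynomial of a primitive [p]-th root of unity
   [z], it suffices to compare the values of both sides at [q = z].  There the
   factor of exponent [s] and index [k] is, up to [(1 - z)^s],
   [u_k v_k^(s-1)] with [u_k = 1/(1 - z^k)] and [v_k = z^k/(1 - z^k)].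
   Reading a composition as a word in commas and pluses, a comma acts on
   functions of [m] by [f |-> sum_(j >= m) u_j f_j] and a plus by
   [f |-> v f].  The lower triangular kernel [kern n m], built from Gaussian
   binomials, intertwines each of these operators with the other one taken for
   [u] and [v] exchanged, and its column sums up to [p - 1] are all [-1]; hence
   exchanging commas and pluses, and [u] and [v], multiplies the sum by [-1].
   The substitution [k |-> p - k] maps [u_k] to [- v_k] and [v_k] to [- u_k]
   and reverses the composition. *)

(** * Nested sums over weakly increasing chains *)

Lemma exchange_triangle (V : nmodType) (a n : nat) (F : nat -> nat -> V) :
  \sum_(a <= i < n) \sum_(i <= j < n) F i j =
  \sum_(a <= j < n) \sum_(a <= i < j.+1) F i j.
Proof.
transitivity (\sum_(a <= i < n) \sum_(a <= j < n | (i <= j)%N) F i j).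
  by apply: eq_big_nat => i /andP[ai _]; rewrite (big_nat_widenl _ a).
rewrite (exchange_big_dep predT) //=; apply: eq_big_nat => j /andP[_ jn].
by rewrite [RHS](big_nat_widen _ _ n).
Qed.

Section ChainSum.

Variables (R : pzSemiRingType) (phi : nat -> nat -> R).

(** The tail starts at [k] itself, as chains increase weakly; [hi] is excluded. *)
Fixpoint chain_sum (lo hi : nat) (s : seq nat) : R :=
  if s is x :: s' then \sum_(lo <= k < hi) phi x k * chain_sum k hi s' else 1.

Lemma chain_sum_tuple (lo hi : nat) (s : seq nat) :
  \sum_(k : (size s).-tuple 'I_hi | path leq lo [seq nat_of_ord x | x <- k])
    \prod_(i < size s) phi (nth 0%N s i) (tnth k i) = chain_sum lo hi s.
Proof.
elim: s lo => [|x s IH] lo /=.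
  rewrite (big_pred1 [tuple]) ?big_ord0 // => k.
  by rewrite (tuple0 k) /=; apply/esym/eqP.
pose cons_pair (u : 'I_hi * (size s).-tuple 'I_hi) := [tuple of u.1 :: u.2].
rewrite (reindex cons_pair) /=; last first.
  exists (fun k => (thead k, [tuple of behead k])) => [[y k] _|k _].
    by congr pair; apply: val_inj.
  by rewrite /cons_pair /= [k in RHS]tuple_eta.
under eq_bigr do rewrite big_ord_recl tnth0.
rewrite (eq_bigr (fun u : 'I_hi * (size s).-tuple 'I_hi => phi x u.1 *
  \prod_(i < size s) phi (nth 0%N s i) (tnth u.2 i))); last first.
  move=> [y k] _; congr (_ * _); apply: eq_bigr => i _ /=.
  by rewrite tnthS.
rewrite -(pair_big_dep (fun y : 'I_hi => lo <= y)%N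
  (fun (y : 'I_hi) (k : (size s).-tuple 'I_hi) =>
     path leq y [seq nat_of_ord x | x <- k])
  (fun y k => phi x y * \prod_(i < size s) phi (nth 0%N s i) (tnth k i))) /=.
under eq_bigr do rewrite -big_distrr IH.
by rewrite (big_nat_widenl _ 0) // big_mkord.
Qed.

Lemma chain_sum_rcons (lo hi x : nat) (s : seq nat) :
  chain_sum lo hi (rcons s x) =
  \sum_(lo <= k < hi) chain_sum lo k.+1 s * phi x k.
Proof.
elim: s lo => [|y s IH] lo /=.
  by apply: eq_bigr => k _; rewrite mulr1 mul1r.
under eq_bigr do rewrite IH mulr_sumr.
rewrite exchange_triangle; apply: eq_bigr => k _.
by rewrite mulr_suml; apply: eq_bigr => j _; rewrite mulrA.
Qed.

End ChainSum.

Lemma eq_chain_sum (R : pzSemiRingType) (phi psi : nat -> nat -> R)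
    (lo hi : nat) (s : seq nat) :
  (forall x k, x \in s -> (lo <= k < hi)%N -> phi x k = psi x k) ->
  chain_sum phi lo hi s = chain_sum psi lo hi s.
Proof.
elim: s lo => //= x s IH lo eq_phi; apply: eq_big_nat => k /andP[lok khi].
rewrite eq_phi ?mem_head ?lok // (IH k) // => y j ys /andP[kj jhi].
by rewrite eq_phi ?in_cons ?ys ?orbT // (leq_trans lok).
Qed.

(** The substitution [k |-> p - k] reverses chains, so the last index on the left is the first on
    the right; a variable [a] lets the induction run. *)
Lemma chain_sum_rev (R : comPzSemiRingType) (phi : nat -> nat -> R)
    (a p : nat) (s : seq nat) : (a <= p)%N ->
  chain_sum phi 1 (p - a).+1 (rev s) =
  chain_sum (fun x k => phi x (p - k)%N) a p s.
Proof.
elim: s a => [|x s IH] a ap //=.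
rewrite rev_cons chain_sum_rcons big_nat_rev big_add1 /= -[a in RHS]add0n big_addn.
apply: eq_big_nat => k /andP[_ kp].
have -> : (1 + (p - a).+1 - k.+2 = p - (k + a))%N by lia.
rewrite IH; last by lia.
have -> : (p - (k + a) = p - a - k)%N by lia.
by rewrite mulrC.
Qed.

(** Homogeneity in the weight, applied with [c = 1 - z] and with [c = -1]. *)
Lemma chain_sum_scale (R : comPzSemiRingType) (phi : nat -> nat -> R) (c : R)
    (lo hi : nat) (s : seq nat) :
  chain_sum (fun x k => c ^+ x * phi x k) lo hi s =
  c ^+ sumn s * chain_sum phi lo hi s.
Proof.
elim: s lo => [|x s IH] lo /=; first by rewrite mulr1.
rewrite mulr_sumr; apply: eq_bigr => k _; rewrite IH exprD.
by rewrite mulrACA.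
Qed.

(** * Compositions encoded by words *)

Definition incr_head (s : seq nat) : seq nat :=
  if s is x :: s' then x.+1 :: s' else [::].

(* A word of length [w - 1] encodes a composition of [w]: between consecutive
   units, [true] stands for a plus sign and [false] for a comma. *)
Fixpoint composition (W : seq bool) : seq nat :=
  match W with
  | [::] => [:: 1%N]
  | true :: W' => incr_head (composition W')
  | false :: W' => 1%N :: composition W'
  end.

Lemma composition_cons (W : seq bool) : exists x s, composition W = x.+1 :: s.
Proof.
elim: W => [|[] W [x [s /= ->]]] /=; first by exists 0%N, [::].
- by exists x.+1, s.
- by exists 0%N, (x.+1 :: s).
Qed.

Lemma composition_gt0 (W : seq bool) x : x \in composition W -> (0 < x)%N.
Proof.
elim: W x => [|[] W IH] x /=; first by rewrite inE => /eqP->.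
- have [y [s def_s]] := composition_cons W; move: IH; rewrite def_s /= => IH.
  rewrite inE => /orP[/eqP-> //|xs]; apply: IH.
  by rewrite inE xs orbT.
- by rewrite inE => /orP[/eqP->|/IH].
Qed.

Lemma sumn_composition (W : seq bool) : sumn (composition W) = (size W).+1.
Proof.
elim: W => [|[] W IH] //=; last by rewrite IH.
by have [x [s def_s]] := composition_cons W; move: IH; rewrite def_s /= !addSn => ->.
Qed.

Lemma composition_rcons_false (W : seq bool) :
  composition (rcons W false) = rcons (composition W) 1%N.
Proof.
elim: W => [|[] W IH] //=; rewrite IH //.
by have [x [s ->]] := composition_cons W.
Qed.

(** A final plus raises the last entry, reached by [incr_head] through two reversals. *)
Lemma composition_rcons_true (W : seq bool) :
  composition (rcons W true) = rev (incr_head (rev (composition W))).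
Proof.
elim: W => [|[] W IH] //=; rewrite IH.
- have [x [s ->]] := composition_cons W.
  case/lastP: s => // s y.
  by rewrite !rev_cons !rev_rcons /= !rev_cons !rev_rcons /= !revK.
- rewrite rev_cons; case def_s: (rev (composition W)) => [|x s] /=.
    have [y [t def_t]] := composition_cons W.
    by move: def_s; rewrite def_t rev_cons -cats1; case: (rev t).
  by rewrite !rev_cons rev_rcons.
Qed.

Lemma composition_rev (W : seq bool) : composition (rev W) = rev (composition W).
Proof.
elim: W => [|[] W IH] //=; rewrite rev_cons.
- by rewrite composition_rcons_true IH revK.
- by rewrite composition_rcons_false IH rev_cons.
Qed.

Lemma composition_nseq_false (c : nat) (W : seq bool) :
  composition (nseq c false ++ W) = nseq c 1%N ++ composition W.
Proof. by elim: c => //= c ->. Qed.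

Lemma composition_nseq_true (c : nat) : composition (nseq c true) = [:: c.+1].
Proof. by elim: c => //= c ->. Qed.

Lemma composition_nseq_true_false (c : nat) (W : seq bool) :
  composition (nseq c true ++ [:: true, false & W]) = c.+2 :: composition W.
Proof. by elim: c => //= c ->. Qed.

(** * Sums indexed by words *)

Section WordSum.

Variables (R : comPzSemiRingType) (p : nat).

Fixpoint word_sum (u v : nat -> R) (W : seq bool) (m : nat) : R :=
  match W with
  | [::] => 1
  | true :: W' => v m * word_sum u v W' m
  | false :: W' => \sum_(m <= j < p) u j * word_sum u v W' j
  end.

(** The outermost summation counts as a comma, hence the added [false]. *)
Lemma chain_sum_composition (u v : nat -> R) (W : seq bool) (lo : nat) :
  chain_sum (fun x k => u k * v k ^+ (x - 1)) lo p (composition W) =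
  word_sum u v (false :: W) lo.
Proof.
set phi := fun x k => _.
(* At a fixed first index [k] the head entry [x.+1] contributes [v k ^+ x]; its factor [u k] comes
   from the comma in front. *)
suff [x [s [-> hW]]] : exists x s, composition W = x.+1 :: s /\
    forall k, word_sum u v W k = v k ^+ x * chain_sum phi k p s.
  by rewrite /=; apply: eq_bigr => k _; rewrite hW /phi subn1 mulrA.
elim: W => [|[] W [x [s [/= -> hW]]]] /=.
- by exists 0%N, [::]; split => // k; rewrite mulr1.
- by exists x.+1, s; split => // k; rewrite hW exprS mulrA.
- exists 0%N, (x.+1 :: s); split => // k; rewrite mul1r /=.
  by apply: eq_bigr => j _; rewrite hW /phi subn1 mulrA.
Qed.

End WordSum.

(** * Duality at a primitive root of unity *)

Section Duality.

Variables (F : fieldType) (p : nat) (z : F).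
Hypothesis z_prim : p.-primitive_root z.

Let u (k : nat) : F := (1 - z ^+ k)^-1.
Let v (k : nat) : F := z ^+ k / (1 - z ^+ k).

Lemma prim_expr_neq1 (k : nat) : (0 < k < p)%N -> 1 - z ^+ k != 0.
Proof.
case/andP=> k0 kp; rewrite subr_eq0 eq_sym -(prim_order_dvd z_prim).
by rewrite gtnNdvd.
Qed.

Lemma prim_root_neq0 : z != 0.
Proof.
apply/eqP => z0; have := prim_expr_order z_prim.
by rewrite z0 expr0n eqn0Ngt (prim_order_gt0 z_prim) => /eqP; rewrite eq_sym oner_eq0.
Qed.

(* Up to sign, [binq n m] is [q^(m(m+1)/2)] times the Gaussian binomial
   coefficient [n choose m] at [q = z]. *)
Definition binq (n m : nat) : F :=
  - \prod_(i < m) (- z ^+ i.+1 * (1 - z ^+ (n - i)) / (1 - z ^+ i.+1)).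

(** The factor [v n / v m] gives [v m * kern n m = v n * binq n m] for [0 < m < p], as the plus case
    requires. *)
Definition kern (n m : nat) : F := v n / v m * binq n m.

Lemma binq_gt (n m : nat) : (n < m)%N -> binq n m = 0.
Proof.
move=> nm; rewrite /binq (bigD1 (Ordinal nm)) //= subnn expr0 subrr.
by rewrite mulr0 !mul0r oppr0.
Qed.

Lemma binqSr (n m : nat) : binq n m.+1 =
  binq n m * (- z ^+ m.+1 * (1 - z ^+ (n - m)) / (1 - z ^+ m.+1)).
Proof. by rewrite /binq big_ord_recr [RHS]mulNr. Qed.

(** Ratio of consecutive rows, multiplied out so as to cover [m = n.+1], where both sides vanish. *)
Lemma binqSl (n m : nat) : (m <= n.+1)%N ->
  binq n.+1 m * (1 - z ^+ (n.+1 - m)) = binq n m * (1 - z ^+ n.+1).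
Proof.
elim: m => [|m IH] mn; first by rewrite /binq !big_ord0 subn0.
rewrite !binqSr subSS; move: (IH (ltnW mn)).
set A := binq n.+1 m; set B := binq n m; set C := (1 - z ^+ m.+1)^-1.
set D := 1 - z ^+ (n.+1 - m); set E := 1 - z ^+ (n - m) => AB.
transitivity (A * D * (- z ^+ m.+1 * E * C)); first by ring.
by rewrite AB; ring.
Qed.

(** Since [z ^+ p = 1], every factor of the product is 1; the leading sign remains. *)
Lemma binq_pred (m : nat) : (m < p)%N -> binq (p - 1) m = -1.
Proof.
move=> mp; rewrite /binq big1 // => i _.
have ip : (0 < i.+1 < p)%N by rewrite (leq_ltn_trans _ mp).
have zi := prim_expr_neq1 ip.
suff -> : - z ^+ i.+1 * (1 - z ^+ (p - 1 - i)) = 1 - z ^+ i.+1 by rewrite divff.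
rewrite mulrBr mulr1 mulNr -exprD.
have -> : (i.+1 + (p - 1 - i) = p)%N by lia.
by rewrite (prim_expr_order z_prim) opprK addrC.
Qed.

(** By the row ratio [binqSl], [kern n.+1 m] is the difference [binq n.+1 m - binq n m]. *)
Lemma sum_kern_col (m n : nat) : (0 < m <= n)%N -> (n < p)%N ->
  \sum_(m <= j < n.+1) kern j m = binq n m.
Proof.
case/andP=> m0; elim: n => [|n IH] mn np; first by lia.
have zn : 1 - z ^+ n.+1 != 0 by apply: prim_expr_neq1.
have zm : 1 - z ^+ m != 0 by apply: prim_expr_neq1; lia.
have z0 := prim_root_neq0.
have [mn' | nm] := leqP m n; last first.
  have -> : m = n.+1 by lia.
  by rewrite big_nat1 /kern divff ?mul1r // mulf_neq0 ?expf_neq0 ?invr_eq0.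
rewrite big_nat_recr // IH //; last by lia.
have z_split : z ^+ n.+1 = z ^+ (n.+1 - m) * z ^+ m by rewrite -exprD subnK.
apply: (mulIf zn); rewrite mulrDl -(binqSl mn) /kern /v.
by move: zn; rewrite z_split => zn; field; rewrite zn zm expf_neq0.
Qed.

(** [kern n m.+1] is [(z ^+ n - z ^+ m) / (1 - z ^+ m)] times [kern n m], and one minus this ratio
    is [u m / u n]. *)
Lemma kern_recr (m n : nat) : (0 < m <= n)%N -> (n < p)%N ->
  u m * kern n m = u n * (kern n m - kern n m.+1).
Proof.
case/andP=> m0 mn np; have z0 := prim_root_neq0.
have zn : 1 - z ^+ n != 0 by apply: prim_expr_neq1; lia.
have zm : 1 - z ^+ m != 0 by apply: prim_expr_neq1; lia.
(* On the diagonal [m.+1] may equal [p], where [1 - z ^+ m.+1] vanishes. *)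
have [nm | lt_mn] := leqP n m.
  have -> : n = m by lia.
  by rewrite [kern m m.+1]/kern binq_gt // mulr0 subr0.
have zm1 : 1 - z ^+ m.+1 != 0 by apply: prim_expr_neq1; lia.
have z_split : z ^+ n = z ^+ (n - m) * z ^+ m by rewrite -exprD subnK.
rewrite /kern binqSr /u /v; move: zn; rewrite z_split => zn.
by field; rewrite zn zm zm1 !expf_neq0.
Qed.

(** Telescoping by [kern_recr], ending at [kern n n.+1 = 0]. *)
Lemma sum_kern_row (m n : nat) : (0 < m <= n)%N -> (n < p)%N ->
  \sum_(m <= j < n.+1) u j * kern n j = u n * kern n m.
Proof.
case/andP=> m0 mn np.
transitivity (\sum_(m <= j < n.+1) u n * (kern n j - kern n j.+1)).
  by apply: eq_big_nat => j mj; rewrite kern_recr //; lia.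
rewrite -mulr_sumr; congr (_ * _).
transitivity (- \sum_(m <= j < n.+1) (kern n j.+1 - kern n j)).
  by rewrite -sumrN; apply: eq_bigr => j _; rewrite opprB.
rewrite telescope_sumr; last by lia.
by rewrite {1}/kern binq_gt // mulr0 sub0r opprK.
Qed.

(** Here [kern n 1] is just [z ^+ n]. *)
Lemma kern1 (n : nat) : (0 < n < p)%N -> u n * kern n 1 = v n.
Proof.
move=> np; have zn := prim_expr_neq1 np.
have z1 : 1 - z ^+ 1 != 0 by apply: prim_expr_neq1; lia.
have z0 := prim_root_neq0.
rewrite /kern /binq /u /v big_ord1 subn0.
by field; rewrite zn z1 z0.
Qed.

Lemma word_sum_kern (W : seq bool) (m : nat) : (0 < m < p)%N ->
  word_sum p u v W m =
  - \sum_(m <= n < p) kern n m * word_sum p v u (map negb W) n.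
Proof.
elim: W m => [|[] W IH] m mp /=.
- under eq_bigr do rewrite mulr1.
  have p_gt0 := prim_order_gt0 z_prim.
  rewrite -[in X in \sum_(_ <= _ < X) _](prednK p_gt0) sum_kern_col; try lia.
  by rewrite -subn1 binq_pred ?opprK //; lia.
(* A plus, dual to a comma: exchanging the sums leaves partial column sums of [kern]. *)
- rewrite IH // mulrN mulr_sumr; congr (- _).
  under [RHS]eq_bigr do rewrite mulr_sumr.
  rewrite exchange_triangle; apply: eq_big_nat => n mn.
  rewrite -mulr_suml sum_kern_col; try lia.
  rewrite !mulrA /kern /v; congr (_ * _).
  have z0 := prim_root_neq0; have zm := prim_expr_neq1 mp.
  have zn : 1 - z ^+ n != 0 by apply: prim_expr_neq1; lia.
  by field; rewrite zn zm expf_neq0.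
(* A comma, dual to a plus: exchanging the sums leaves row sums weighted by [u]. *)
- under eq_big_nat => j mj.
    rewrite IH; last by lia.
    rewrite mulrN mulr_sumr; over.
  rewrite sumrN exchange_triangle; congr (- _); apply: eq_big_nat => n mn.
  under eq_bigr do rewrite mulrA.
  rewrite -mulr_suml sum_kern_row; try lia.
  by rewrite [RHS]mulrCA mulrA.
Qed.

(** The leading comma becomes a plus, with factor [u n]; the first column of [kern] then turns this
    back into a comma, with factor [v n]. *)
Lemma word_sum_dual (W : seq bool) : (1 < p)%N ->
  word_sum p u v (false :: W) 1 =
  - word_sum p v u (false :: map negb W) 1.
Proof.
move=> p1; rewrite word_sum_kern //=; congr (- _); apply: eq_big_nat => n np.
by rewrite mulrA [kern _ _ * _]mulrC kern1.
Qed.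

Lemma chain_sum_dual (W : seq bool) : (1 < p)%N ->
  let phi x k := u k * v k ^+ (x - 1) in
  chain_sum phi 1 p (composition W) =
  (-1) ^+ size W * chain_sum phi 1 p (rev (composition (map negb W))).
Proof.
move=> p1 phi.
(* The upper bound takes the form [(p - a).+1] with [a = 1] in order to apply [chain_sum_rev]. *)
have -> : p = (p - 1).+1 by lia.
rewrite chain_sum_rev; last by lia.
have -> : (p - 1).+1 = p by lia.
rewrite chain_sum_composition word_sum_dual // -chain_sum_composition.
have -> : chain_sum (fun x k => phi x (p - k)%N) 1 p (composition (map negb W)) =
    chain_sum (fun x k => (-1) ^+ x * (v k * u k ^+ (x - 1))) 1 p
      (composition (map negb W)).
  apply: eq_chain_sum => x k /composition_gt0 x0 kp; rewrite /phi.
  have z0 := prim_root_neq0; have zk := prim_expr_neq1 kp.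
  have zpk : z ^+ (p - k) = (z ^+ k)^-1.
    apply: (mulIf (expf_neq0 k z0)); rewrite -exprD subnK; last by lia.
    by rewrite (prim_expr_order z_prim) mulVf ?expf_neq0.
  have nzk : z ^+ k - 1 != 0 by rewrite -opprB oppr_eq0.
  have -> : u (p - k)%N = - v k.
    by rewrite /u /v zpk; field; rewrite expf_neq0 // zk nzk.
  have -> : v (p - k)%N = - u k.
    by rewrite /u /v zpk; field; rewrite expf_neq0 // zk nzk.
  case: x x0 => // x _; rewrite subn1 /= [(- u k) ^+ x]exprNn exprS mulN1r !mulNr.
  by rewrite mulrCA.
(* The weight is [(size W).+1], so the two signs multiply to the -1 of [word_sum_dual]. *)
rewrite chain_sum_scale sumn_composition size_map mulrA -exprD addnS.
by rewrite -signr_odd /= oddD addbb /= expr1 mulN1r.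
Qed.

End Duality.

(** * Values of rational functions at an algebraic number *)

Definition Qhorner (f : {poly rat}) (z : algC) : algC := (map_poly ratr f).[z].

(** A relation, since a value exists only when some fraction for [A] has a denominator not vanishing
    at [z]. *)
Definition specializes (z : algC) (A : ratfun) (y : algC) : Prop :=
  exists f g : {poly rat},
    [/\ Qhorner g z != 0, A = toF f / toF g & y = Qhorner f z / Qhorner g z].

Lemma Qhorner1 (z : algC) : Qhorner 1 z = 1.
Proof. by rewrite /Qhorner rmorph1 hornerC. Qed.

Lemma QhornerM (f g : {poly rat}) (z : algC) :
  Qhorner (f * g) z = Qhorner f z * Qhorner g z.
Proof. by rewrite /Qhorner rmorphM hornerM. Qed.

Lemma toFD (f g : {poly rat}) : toF (f + g) = toF f + toF g.
Proof. exact: tofracD. Qed.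

Lemma toFM (f g : {poly rat}) : toF (f * g) = toF f * toF g.
Proof. exact: tofracM. Qed.

Lemma toFN (f : {poly rat}) : toF (- f) = - toF f.
Proof. exact: tofracN. Qed.

Lemma toFX (f : {poly rat}) (n : nat) : toF (f ^+ n) = toF f ^+ n.
Proof. exact: tofracXn. Qed.

Lemma toF_Qhorner_neq0 (g : {poly rat}) (z : algC) :
  Qhorner g z != 0 -> toF g != 0.
Proof.
apply: contraNneq => /eqP; rewrite tofrac_eq0 => /eqP->.
by rewrite /Qhorner rmorph0 horner0.
Qed.

Section Specializes.

Variable z : algC.

Lemma specializes_poly (f : {poly rat}) : specializes z (toF f) (Qhorner f z).
Proof.
by exists f, 1; rewrite Qhorner1 oner_neq0 /toF tofrac1 !divr1.
Qed.

Lemma specializesD (A B : ratfun) (x y : algC) :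
  specializes z A x -> specializes z B y -> specializes z (A + B) (x + y).
Proof.
move=> [f [g [g0 -> ->]]] [h [k [k0 -> ->]]].
exists (f * k + h * g), (g * k).
have gF := toF_Qhorner_neq0 g0; have kF := toF_Qhorner_neq0 k0.
rewrite QhornerM; split; first by rewrite mulf_neq0.
  by rewrite (addf_div _ _ gF kF) toFD !toFM.
by rewrite (addf_div _ _ g0 k0) -!QhornerM /Qhorner rmorphD hornerD.
Qed.

Lemma specializesM (A B : ratfun) (x y : algC) :
  specializes z A x -> specializes z B y -> specializes z (A * B) (x * y).
Proof.
move=> [f [g [g0 -> ->]]] [h [k [k0 -> ->]]].
exists (f * h), (g * k); rewrite !QhornerM; split; first by rewrite mulf_neq0.
  by rewrite mulf_div !toFM.
by rewrite mulf_div.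
Qed.

Lemma specializesV (A : ratfun) (x : algC) :
  specializes z A x -> x != 0 -> specializes z A^-1 x^-1.
Proof.
move=> [f [g [g0 -> ->]]]; rewrite mulf_eq0 negb_or => /andP[f0 _].
by exists g, f; rewrite !invf_div.
Qed.

Lemma specializesN (A : ratfun) (x : algC) :
  specializes z A x -> specializes z (- A) (- x).
Proof.
move=> [f [g [g0 -> ->]]]; exists (- f), g; split; first exact: g0.
  by rewrite toFN mulNr.
by rewrite /Qhorner rmorphN hornerN mulNr.
Qed.

Lemma specializes1 : specializes z 1 1.
Proof. by have := specializes_poly 1; rewrite Qhorner1 /toF tofrac1. Qed.

Lemma specializes_sign (n : nat) : specializes z ((-1) ^+ n) ((-1) ^+ n).
Proof.
elim: n => [|n IH]; first exact: specializes1.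
by rewrite !exprS !mulN1r; apply: specializesN.
Qed.

Lemma specializes_chain_sum (phi : nat -> nat -> ratfun)
    (psi : nat -> nat -> algC) (lo hi : nat) (s : seq nat) :
  (forall x k, x \in s -> (lo <= k < hi)%N ->
    specializes z (phi x k) (psi x k)) ->
  specializes z (chain_sum phi lo hi s) (chain_sum psi lo hi s).
Proof.
have spec0 : specializes z 0 0.
  by have := specializes_poly 0; rewrite /Qhorner rmorph0 horner0 /toF tofrac0.
elim: s lo => [|x s IH] lo phi_psi /=; first exact: specializes1.
rewrite big_nat_cond [X in specializes _ _ X]big_nat_cond.
apply: (big_ind2 (specializes z)); first exact: spec0.
  by move=> A x1 B x2; apply: specializesD.
move=> k /andP[/andP[lok khi] _].
apply: specializesM; first by apply: phi_psi; rewrite ?mem_head ?lok.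
apply: IH => y j ys /andP[kj jhi].
by apply: phi_psi; rewrite ?in_cons ?ys ?orbT // (leq_trans lok).
Qed.

End Specializes.

(** * The multiple sum at a root of unity *)

Lemma Sq_chain_sum (n : nat) (s : seq nat) :
  Sq n s = chain_sum (fun x k => qvar ^+ ((x - 1) * k) / toF (qint k) ^+ x)
             1 n.+1 s.
Proof. by rewrite -chain_sum_tuple. Qed.

Lemma Qhorner_qint (n : nat) (z : algC) :
  (1 - z) * Qhorner (qint n) z = 1 - z ^+ n.
Proof.
rewrite /Qhorner /qint rmorph_sum horner_sum -[RHS]opprB subrX1 -mulNr opprB.
by congr (_ * _); apply: eq_bigr => i _; rewrite /= map_polyXn hornerXn.
Qed.

(** At [q = z], [[k]_q] is [(1 - z ^+ k) / (1 - z)], nonzero for [0 < k < p]; the powers of [1 - z]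
    collect to the weight. *)
Lemma specializes_Sq_composition (p : nat) (z : algC) (W : seq bool) :
  p.-primitive_root z -> (1 < p)%N ->
  specializes z (Sq (p - 1) (composition W))
    ((1 - z) ^+ (size W).+1 *
     chain_sum (fun x k => (1 - z ^+ k)^-1 * (z ^+ k / (1 - z ^+ k)) ^+ (x - 1))
       1 p (composition W)).
Proof.
move=> z_prim p1; rewrite Sq_chain_sum -sumn_composition -chain_sum_scale subn1.
rewrite prednK; last by lia.
apply: specializes_chain_sum => x k /composition_gt0 x0 kp.
have zk := prim_expr_neq1 z_prim kp.
have z1 : 1 - z != 0 by have := @prim_expr_neq1 _ _ _ z_prim 1; rewrite expr1; apply; lia.
have kz := Qhorner_qint k z.
have qk : Qhorner (qint k) z != 0.
  by apply: contraNneq zk => qk0; rewrite -kz qk0 mulr0.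
have -> : (1 - z) ^+ x * ((1 - z ^+ k)^-1 * (z ^+ k / (1 - z ^+ k)) ^+ (x - 1))
   = Qhorner 'X^((x - 1) * k) z / Qhorner (qint k ^+ x) z.
  rewrite -kz /Qhorner map_polyXn hornerXn rmorphXn horner_exp mulnC exprM.
  rewrite -/(Qhorner _ _).
  case: x x0 => // x _; rewrite subn1 /= !exprS !exprMn exprVn exprMn.
  by field; rewrite qk z1 !expf_neq0.
rewrite /qvar -!toFX.
apply: specializesM; first exact: specializes_poly.
apply: specializesV; first exact: specializes_poly.
by rewrite /Qhorner rmorphXn horner_exp expf_neq0.
Qed.

(** * From equal values to congruence modulo [[p]_q] *)

Lemma size_qint (n : nat) : size (qint n) = n.
Proof.
have -> : qint n = \poly_(i < n) 1.
  by rewrite poly_def; apply: eq_bigr => i _; rewrite scale1r.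
case: n => [|n]; first by rewrite poly_def big_ord0 size_poly0.
by rewrite size_poly_eq ?oner_neq0.
Qed.

(** The minimal polynomial of [z] is cyclotomic of degree [p - 1]; it divides [[p]_q], which has the
    same degree. *)
Lemma qint_minpoly (p : nat) (z : algC) (f : {poly rat}) :
  prime p -> p.-primitive_root z -> Qhorner f z = 0 <-> qint p %| f.
Proof.
move=> p_prime z_prim; have [m [def_m _ rootP]] := minCpolyP z.
suff mq : m %= qint p.
  by rewrite -(eqp_dvdl _ mq) -rootP; split => /eqP.
have z1 : 1 - z != 0.
  have := @prim_expr_neq1 _ _ _ z_prim 1; rewrite expr1; apply.
  exact: prime_gt1.
have m_dvd : m %| qint p.
  rewrite -rootP; apply/eqP/(mulfI z1); rewrite -/(Qhorner _ _) Qhorner_qint.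
  by rewrite (prim_expr_order z_prim) subrr mulr0.
rewrite -(dvdp_size_eqp m_dvd) -(size_map_poly (ratr : rat -> algC)) -def_m.
rewrite (minCpoly_cyclotomic z_prim) size_cyclotomic totient_prime //.
rewrite prednK ?prime_gt0 //.
by rewrite size_qint.
Qed.

(** The gcd divides [g], so it does not vanish at [z]; its cofactor in [[p]_q] does, hence is a
    multiple of [[p]_q], and the gcd is constant. *)
Lemma coprimep_qint (p : nat) (z : algC) (g : {poly rat}) :
  prime p -> p.-primitive_root z -> Qhorner g z != 0 -> coprimep g (qint p).
Proof.
move=> p_prime z_prim g0; have minP := fun f => @qint_minpoly p z f p_prime z_prim.
have q0 : qint p != 0 by rewrite -size_poly_gt0 size_qint prime_gt0.
have d0 : gcdp g (qint p) != 0 by rewrite gcdp_eq0 (negPf q0) andbF.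
have g_gcd := divpK (dvdp_gcdl g (qint p)).
have q_gcd := divpK (dvdp_gcdr g (qint p)).
have : Qhorner (qint p) z = 0 by apply/minP.
rewrite -{1}q_gcd QhornerM => /eqP; rewrite mulf_eq0 => /orP[|/eqP dz]; last first.
  by rewrite -g_gcd QhornerM dz mulr0 eqxx in g0.
move=> /eqP/minP q_dvd; have e0 : qint p %/ gcdp g (qint p) != 0.
  by apply: contraNneq q0 => e0; rewrite -q_gcd e0 mul0r.
have := dvdp_leq e0 q_dvd; rewrite size_divp // size_qint => p_le.
rewrite coprimep_def; have := prime_gt0 p_prime; have := d0.
by rewrite -size_poly_gt0; lia.
Qed.

Lemma specializes_qcongr (p : nat) (z : algC) (A B : ratfun) (y : algC) :
  prime p -> p.-primitive_root z ->
  specializes z A y -> specializes z B y -> qcongr (qint p) A B.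
Proof.
move=> p_prime z_prim Ay By.
have := specializesD Ay (specializesN By); rewrite subrr.
rewrite /qcongr => -[f [g [g0 -> /eqP]]].
rewrite eq_sym mulf_eq0 invr_eq0 (negPf g0) orbF => /eqP f0.
(* With [f = f1 / a] and [g = g1 / b], the integral witnesses are [b f1] and [a g1]. *)
have [f1 [a a0 def_f]] := rat_poly_scale f.
have [g1 [b b0 def_g]] := rat_poly_scale g.
have aQ : (a%:~R : rat) != 0 by rewrite intr_eq0.
have bQ : (b%:~R : rat) != 0 by rewrite intr_eq0.
have Qf : ZtoQ (b *: f1) = (b%:~R * a%:~R) *: f.
  by rewrite /ZtoQ map_polyZ def_f scalerA mulfK.
have Qg : ZtoQ (a *: g1) = (b%:~R * a%:~R) *: g.
  by rewrite /ZtoQ map_polyZ def_g scalerA [_ * a%:~R]mulrC mulfK.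
have ab : (b%:~R * a%:~R : rat) != 0 by rewrite mulf_neq0.
exists (b *: f1), (a *: g1); rewrite Qf Qg; split.
- rewrite -mul_polyC mulf_neq0 ?polyC_eq0 //; apply: contraNneq g0 => g10.
  by rewrite def_g g10 /Qhorner rmorph0 scaler0 rmorph0 horner0.
- have abF : toF (b%:~R * a%:~R)%:P != 0 by rewrite tofrac_eq0 polyC_eq0.
  by rewrite -!mul_polyC !toFM -mulf_div (divff abF) mul1r.
- by rewrite (eqp_coprimepl _ (eqp_scale _ ab)) (coprimep_qint p_prime z_prim).
- by rewrite dvdpZr // -(qint_minpoly _ p_prime z_prim).
Qed.

(** * Argument sequences as words made of blocks *)

Definition block (d : nat * nat) : seq bool := nseq d.1 false ++ nseq d.2 true.

Definition swap (d : nat * nat) : nat * nat := (d.2, d.1).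

(** A pair is [(a_j - 1, b_j - 1)]. The separator plus, comma raises the last entry of the preceding
    block from [b_j] to [b_j + 1] and closes it; [drop 2] removes the initial one. *)
Definition blocks (ds : seq (nat * nat)) : seq bool :=
  flatten [seq [:: true, false & block d] | d <- ds].

Lemma blocks_cat (ds es : seq (nat * nat)) :
  blocks (ds ++ es) = blocks ds ++ blocks es.
Proof. by rewrite /blocks map_cat flatten_cat. Qed.

Lemma blocks_cons (d : nat * nat) (ds : seq (nat * nat)) :
  blocks (d :: ds) = [:: true; false] ++ drop 2 (blocks (d :: ds)).
Proof. by rewrite /blocks /= drop0. Qed.

(* The separator [true; false] between blocks is invariant under negation
   followed by reversal. *)
Lemma blocks_dual (ds : seq (nat * nat)) :
  drop 2 (blocks (rev [seq swap d | d <- ds])) =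
  rev (map negb (drop 2 (blocks ds))).
Proof.
(* For the induction all separators are kept, with one more in front on the left and at the end on
   the right. *)
have rev_blocks ds' : [:: true; false] ++ rev (map negb (blocks ds')) =
    blocks (rev [seq swap d | d <- ds']) ++ [:: true; false].
  elim: ds' => // d ds' IH.
  rewrite map_cons rev_cons -cats1 blocks_cat.
  have -> : blocks (d :: ds') = [:: true; false] ++ block d ++ blocks ds' by [].
  rewrite !map_cat !rev_cat !catA IH -!catA; congr (_ ++ _).
  by rewrite /= !map_nseq !rev_nseq /block -catA.
case: ds => // d ds; have := rev_blocks (d :: ds); rewrite blocks_cons.
case def_es : (rev [seq swap e | e <- d :: ds]) => [|e es].
  by have := size_rev [seq swap e | e <- d :: ds]; rewrite def_es.
rewrite (blocks_cons e) !map_cat rev_cat -catA => -[].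
move/(congr1 rev); rewrite !rev_cat => -[/(can_inj revK) dual_eq].
by rewrite /= !drop0 in dual_eq *; rewrite dual_eq.
Qed.

Lemma size_blocks (ds : seq (nat * nat)) :
  size (blocks ds) = (\sum_(d <- ds) (d.1.+1 + d.2.+1))%N.
Proof.
elim: ds => [|d ds IH]; first by rewrite big_nil.
by rewrite big_cons -IH /blocks /= !size_cat !size_nseq; lia.
Qed.

Lemma composition_blocks (x y : nat -> nat) (r : nat) : (0 < r)%N ->
  (forall j, (1 <= j <= r)%N -> (0 < y j)%N) ->
  Cat (r - 1) (fun j => nseq (x j - 1) 1%N ++ [:: (y j + 1)%N])
    ++ nseq (x r - 1) 1%N ++ [:: y r] =
  composition (drop 2 (blocks [seq (x j - 1, y j - 1)%N | j <- index_iota 1 r.+1])).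
Proof.
case: r => // r _ y_gt0; rewrite /Cat subn1 -pred_Sn.
have -> : index_iota 1 r.+2 = rcons (index_iota 1 r.+1) r.+1.
  by rewrite /index_iota !subn1 -!pred_Sn -{1}(addn1 r) iotaD cats1.
have : {in index_iota 1 r.+1, forall j, 0 < y j}%N.
  by move=> j; rewrite mem_index_iota => jr; apply: y_gt0; lia.
have : (0 < y r.+1)%N by apply: y_gt0; lia.
(* The initial indices become an arbitrary list; only the last block, followed by no separator, is
   special. *)
elim: (index_iota 1 r.+1) => [|j js IH] yr yjs.
  rewrite big_nil /blocks /= drop0 cats0 /block.
  rewrite composition_nseq_false composition_nseq_true.
  by congr (_ ++ [:: _]); rewrite /= subn1 prednK.
have yj : (0 < y j)%N by rewrite yjs ?mem_head.
rewrite big_cons -catA IH //; last by move=> i i_js; rewrite yjs ?in_cons ?i_js ?orbT.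
rewrite -catA /blocks /= drop0 -/(blocks _).
have [d [ds ->]] : exists d ds,
    [seq (x j - 1, y j - 1)%N | j <- rcons js r.+1] = d :: ds.
  by case: (js) => [|i ks]; do 2 eexists.
rewrite [blocks (d :: ds)]blocks_cons /block -catA composition_nseq_false.
rewrite composition_nseq_true_false /=; congr (_ ++ _ :: _); last by rewrite /= !drop0.
by rewrite subn1 addn1 prednK.
Qed.

Theorem theorem7p1 (p : nat) (p_prime : prime p)
    (r : nat) (r_gt0 : (0 < r)%N)
    (a b : nat -> nat)
    (a_gt0 : forall j, (1 <= j <= r)%N -> (0 < a j)%N)
    (b_gt0 : forall j, (1 <= j <= r)%N -> (0 < b j)%N) :
  qcongr (qint p)
    (Sq (p - 1)
       (Cat (r - 1) (fun j => nseq (a j - 1) 1%N ++ [:: (b j + 1)%N])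
        ++ nseq (a r - 1) 1%N ++ [:: b r]))
    ((-1) ^+ (\sum_(1 <= j < r.+1) (a j + b j))%N *
     Sq (p - 1)
       (Cat (r - 1)
          (fun j => nseq (b (r - j + 1)%N - 1) 1%N ++ [:: (a (r - j + 1) + 1)%N])
        ++ nseq (b 1%N - 1) 1%N ++ [:: a 1%N])).

Proof.
have p_gt1 := prime_gt1 p_prime.
have [z z_prim] := C_prim_root_exists (prime_gt0 p_prime).
rewrite composition_blocks //.
(* The final block follows the pattern [r - j + 1] at [j = r]. *)
have -> : b 1%N = b (r - r + 1)%N by rewrite subnn.
have -> : a 1%N = a (r - r + 1)%N by rewrite subnn.
rewrite (composition_blocks (fun j => b (r - j + 1)%N)) //; last first.
  by move=> j jr; apply: a_gt0; lia.
set ds := [seq (a j - 1, b j - 1)%N | j <- index_iota 1 r.+1].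
have -> : [seq (b (r - j + 1) - 1, a (r - j + 1) - 1)%N | j <- index_iota 1 r.+1] =
    rev [seq swap d | d <- ds].
  rewrite -map_comp -map_rev.
  rewrite /index_iota subSS subn0.
  apply: (@eq_from_nth _ (0, 0)%N) => [|i].
    by rewrite !size_map size_rev.
  rewrite !size_map ?size_iota => ir.
  rewrite (nth_map 0%N) ?size_iota // (nth_map 0%N) ?size_rev ?size_iota //.
  rewrite nth_rev ?size_iota // !nth_iota //; last by lia.
  by rewrite /swap /=; congr (b _ - 1, a _ - 1)%N; lia.
have sum_ab : (\sum_(1 <= j < r.+1) (a j + b j) = size (blocks ds))%N.
  rewrite size_blocks big_map; apply: eq_big_nat => j jr /=.
  have := a_gt0 j jr; have := b_gt0 j jr; lia.
(* Dropping the initial separator removes two letters and keeps the parity. *)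
have -> : (-1) ^+ (\sum_(1 <= j < r.+1) (a j + b j))%N =
    (-1) ^+ size (drop 2 (blocks ds)) :> ratfun.
  rewrite sum_ab /ds; case: (r) r_gt0 => // r' _.
  by rewrite /index_iota /= drop0 !exprS !mulN1r opprK.
(* What remains holds for every word [W]. *)
rewrite blocks_dual; move: (drop _ _) => W.
apply: (specializes_qcongr p_prime z_prim (specializes_Sq_composition _ z_prim p_gt1)).
rewrite chain_sum_dual // mulrCA.
apply: specializesM; first exact: specializes_sign.
rewrite -composition_rev -(size_map negb W) -size_rev.
exact: specializes_Sq_composition.
Qed.
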